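(* For $i\in\mathbb{N}$ let $a_i=\lfloor 3i/2\rfloor$ and $b_i=3i-1$, and let $$S=\{\{a_i,b_i\}\mid i\in\mathbb{N}\}\cup\{(0,0)\}.$$ Define \begin{align*} \mathcal{M}_0&=\{(1,1),(3,3),\{3,4\},(4,4),\{4,7\},(6,6),\{6,7\},\{6,10\}\},\\ \mathcal{M}_1&=\{\{a_{2n-1},a_{2m-1}\}\mid m,n\in\mathbb{N},\ 3\le n\le m\le 2n-1\},\\ \mathcal{M}_2&=\{\{a_{2n},a_{2m}\}\mid m,n\in\mathbb{N},\ 3\le n\le m<2n-2\},\\ \mathcal{M}_3&=\{\{a_{2n},a_{4n-1}\},\{a_{2n},a_{4n-3}\}\mid n\in\mathbb{N},\ n\ge 3\},\\ \mathcal{M}_4&=\{\{0,x\}\mid x\in\mathbb{N}\}. \end{align*} Let $G$ (the game ''the Mouse trap'') be the invariant subtraction game with $\mathcal{M}(G)=\bigcup_{i=0}^4\mathcal{M}_i$. Then $\mathcal{P}(G)=S$.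
   Context: $\mathbb{N}=\{1,2,3,\dots\}$, $\mathbb{N}_0=\{0,1,2,\dots\}$. Symmetric notation: inside sets of positions or moves, $\{x,y\}$ stands for both ordered pairs $(x,y)$ and $(y,x)$. An invariant subtraction game $G$ on $\mathbb{N}_0\times\mathbb{N}_0$ is given by a set of moves $\mathcal{M}(G)\subseteq(\mathbb{N}_0\times\mathbb{N}_0)\setminus\{(0,0)\}$; from position $(x,y)$ the options are all $(x-i,y-j)$ with $(i,j)\in\mathcal{M}(G)$, $i\le x$, $j\le y$. Two players alternate and a player who cannot move loses. A position is $P$ if all its options are $N$ (in particular if it has no options) and is $N$ if it has at least one $P$ option; $\mathcal{P}(G)$ is the set of $P$-positions. *)

(* Defs.v *)
(* MathComp world, with the classical sets of MathComp-Analysis. *)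
From mathcomp Require Import all_boot.
From mathcomp Require Import classical_sets.

Set Implicit Arguments.
Unset Strict Implicit.
Unset Printing Implicit Defensive.

Local Open Scope classical_set_scope.

Record inv_game := InvGame {
  moves : set (nat * nat);
  moves_neq0 : ~ moves (0, 0) }.

Definition options (G : inv_game) (p : nat * nat) : set (nat * nat) :=
  [set q | exists i j, [/\ moves G (i, j), i <= p.1, j <= p.2 &
                           q = (p.1 - i, p.2 - j)]].

(* As (0, 0) is not a move, play always terminates, so every position satisfies
   exactly one of [is_P G] and [is_N G] (see [is_P_or_N], [is_P_not_N]). *)
Inductive is_P (G : inv_game) (p : nat * nat) : Prop :=
  | IsP of (forall q, options G p q -> is_N G q)
with is_N (G : inv_game) (p : nat * nat) : Prop :=
  | IsN q of options G p q & is_P G q.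

Definition P_positions (G : inv_game) : set (nat * nat) := [set p | is_P G p].

Lemma options_lt (G : inv_game) p q : options G p q -> q.1 + q.2 < p.1 + p.2.
Proof.
case=> i [j [Mij lei lej ->]] /=.
case: i j Mij lei lej => [|i] [|j] Mij lei lej.
- by case: (moves_neq0 Mij).
- by rewrite subn0 ltn_add2l ltn_subrL (leq_trans _ lej).
- by rewrite subn0 ltn_add2r ltn_subrL (leq_trans _ lei).
- by rewrite -addnS leq_add ?leq_subr // ltn_subrL (leq_trans _ lej).
Qed.

Lemma is_P_or_N (G : inv_game) p : is_P G p \/ is_N G p.
Proof.
have [k] := ubnP (p.1 + p.2); elim: k p => // k IHk p lepk.
have [[q [Oq Pq]]|noP] := boolp.pselect (exists q, options G p q /\ is_P G q).
  by right; apply: IsN Oq Pq.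
left; constructor=> q Oq.
case: (IHk q) => // [|Pq]; first exact: leq_trans (options_lt Oq) lepk.
by case: noP; exists q.
Qed.

Lemma is_P_not_N (G : inv_game) p : is_P G p -> ~ is_N G p.
Proof.
have [k] := ubnP (p.1 + p.2); elim: k p => // k IHk p lepk [NP] [q Oq Pq].
by apply: IHk Pq (NP q Oq); apply: leq_trans (options_lt Oq) lepk.
Qed.

(* The symmetric notation {x, y}, both ordered pairs. *)
Definition sym (x y : nat) : set (nat * nat) := [set (x, y); (y, x)].

(* Used only for 0 < i, so the truncated subtraction in [b] is the usual one. *)
Definition a (i : nat) : nat := (3 * i) %/ 2.
Definition b (i : nat) : nat := 3 * i - 1.

Definition S_set : set (nat * nat) :=
  [set p | exists i, 0 < i /\ sym (a i) (b i) p] `|` [set (0, 0)].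

Definition M0 : set (nat * nat) :=
  [set (1, 1)] `|` [set (3, 3)] `|` sym 3 4 `|` [set (4, 4)] `|` sym 4 7
  `|` [set (6, 6)] `|` sym 6 7 `|` sym 6 10.

(* All subtractions in [M1], [M2] and [M3] are exact since 3 <= n <= m. *)
Definition M1 : set (nat * nat) :=
  [set p | exists m n, [/\ 3 <= n, n <= m, m <= 2 * n - 1 &
                           sym (a (2 * n - 1)) (a (2 * m - 1)) p]].

Definition M2 : set (nat * nat) :=
  [set p | exists m n, [/\ 3 <= n, n <= m, m < 2 * n - 2 &
                           sym (a (2 * n)) (a (2 * m)) p]].

Definition M3 : set (nat * nat) :=
  [set p | exists n, 3 <= n /\
    (sym (a (2 * n)) (a (4 * n - 1)) `|` sym (a (2 * n)) (a (4 * n - 3))) p].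

Definition M4 : set (nat * nat) := [set p | exists x, 0 < x /\ sym 0 x p].

Definition mouse_trap_moves : set (nat * nat) :=
  M0 `|` M1 `|` M2 `|` M3 `|` M4.

Lemma a_gt0 i : 0 < i -> 0 < a i.
Proof. by move=> i0; rewrite /a divn_gt0 // (leq_trans _ (leq_pmulr 3 i0)). Qed.

Lemma sym_neq0 x y : 0 < y -> ~ sym x y (0, 0).
Proof. by move=> + [[_ y0]|[y0 _]]; rewrite -y0. Qed.

Lemma mouse_trap_moves_neq0 : ~ mouse_trap_moves (0, 0).
Proof.
have a2n n : 3 <= n -> 0 < a (2 * n).
  by move=> n3; apply: a_gt0; rewrite muln_gt0 (leq_trans _ n3).
have ak k c n : c < k -> 3 <= n -> 0 < a (k * n - c).
  move=> ck n3; apply: a_gt0; rewrite subn_gt0 (leq_trans ck) // leq_pmulr //.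
  exact: leq_trans n3.
case=> [[[[M|]|]|]|].
- by move: M; rewrite /M0 /sym /=; intuition congruence.
- by case=> m [n [n3 nm _]]; apply/sym_neq0/ak => //; apply: leq_trans nm.
- by case=> m [n [n3 nm _]]; apply/sym_neq0/a2n; apply: leq_trans nm.
- by case=> n [n3] [] /=; apply/sym_neq0/ak.
- by case=> x [x0]; apply: sym_neq0.
Qed.

Definition mouse_trap : inv_game := InvGame mouse_trap_moves_neq0.

(* Main.v *)
Require Import Defs.
From mathcomp Require Import all_boot.
From mathcomp Require Import classical_sets.
From mathcomp Require Import zify.

(** The set of P-positions of a game is its unique kernel: no option of a
    position in the set lies in the set, and every position outside the set has
    an option inside it ([P_positions_kernel]).  So it suffices to check these
    two properties for [S_set].

    Since a (2n-1) = 3n-2 and a (2n) = 3n, everything becomes linear arithmetic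
    modulo 3.  Up to swapping coordinates, the positions of [S_set] are (0, 0),
    the pairs (x, 2x) with x = 1 mod 3 and the pairs (x, 2x-1) with x > 0 and
    x = 0 mod 3 ([S_setP]); and the moves (i, j) with i <= j are those of
    [ordered_move] ([mouse_trap_movesP]).  Up to swapping, each natural number
    occurs as a coordinate in exactly one pair; call the other coordinate its
    partner.

    No move stays inside [S_set] ([S_set_indep]).  A move that did would change
    both coordinates, and a move (i, j) with i and j positive has i and j equal
    to 0 or 1 mod 3 and satisfies j < 2i ([ordered_move_bounds]).  It would not
    lead to (0, 0), because every other pair has a coordinate that is 2 mod 3.
    For two nonzero positions with the same orientation, (x, 2x-e) and
    (u, 2u-f), the difference is (t, 2t-e+f) with t = x-u.  It is too steep
    unless e = 1 and f = 0, and then t = 2 mod 3.  For (x, 2x-e) and (2u-f, u)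
    the residues of the difference are both less than 2 only when they are
    (1, 1), with e = 1 and f = 0; but then the difference (x-2u, 2x-1-u) is too
    steep again.

    Every position outside [S_set] has a move into it ([N_position_move]).  Let
    x <= y.  If x or y is 2 mod 3, or if y is larger than the partner of x, it
    suffices to decrease one coordinate, to the partner of the other one.
    Otherwise, apart from finitely many pairs, one of (x, y), (x-3, y-5) and
    (x-5, y-3) is a move, so that (0, 0), (3, 5) or (5, 3) can be reached.  The
    remaining pairs have x < 12 and are what the moves in [M0] are for. *)

Set Implicit Arguments.
Unset Strict Implicit.
Unset Printing Implicit Defensive.

Local Open Scope classical_set_scope.

(** * Kernels *)

Lemma P_positions_kernel (G : inv_game) (K : set (nat * nat)) :
  (forall p q, K p -> options G p q -> ~ K q) ->
  (forall p, ~ K p -> exists q, options G p q /\ K q) ->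
  P_positions G = K.
Proof.
move=> indep absorb.
have main k p : p.1 + p.2 < k -> is_P G p <-> K p.
  elim: k p => // k IHk p lepk.
  have IHo q : options G p q -> is_P G q <-> K q.
    by move=> /options_lt ltqp; apply: IHk; apply: leq_trans ltqp lepk.
  split=> [Pp|Kp].
    case: (boolp.pselect (K p)) => // /absorb[q [Oq Kq]].
    by case: (is_P_not_N Pp); apply: (IsN Oq); apply/(IHo _ Oq).
  constructor=> q Oq; have [/(IHo _ Oq)|//] := is_P_or_N G q.
  by move/(indep _ _ Kp Oq).
by apply/seteqP; split=> p; have [] := main _ p (ltnSn _).
Qed.

(** * Residues modulo 3 *)

(** The positions (x, y) of [S_set] with x <= y. *)
Definition ordered_pos (x y : nat) : Prop :=
  [\/ x = 0 /\ y = 0, x %% 3 = 1 /\ y = 2 * x |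
      [/\ 0 < x, x %% 3 = 0 & y + 1 = 2 * x]].

(** The moves (i, j) with i <= j, with one clause for each of [M0], [M1], [M2],
    [M3] and [M4]. *)
Definition ordered_move (i j : nat) : Prop :=
  [\/ (i, j) \in [:: (1, 1); (3, 3); (3, 4); (4, 4); (4, 7); (6, 6); (6, 7);
                     (6, 10)],
      [/\ i %% 3 = 1, j %% 3 = 1, 7 <= i & i <= j < 2 * i],
      [/\ i %% 3 = 0, j %% 3 = 0, 9 <= i & i <= j <= 2 * i - 9] |
      [/\ i %% 3 = 0, 9 <= i & j + 2 = 2 * i \/ j + 5 = 2 * i] \/
      i = 0 /\ 0 < j].

Lemma symP (P : nat -> nat -> Prop) u v x y :
  sym u v (x, y) -> P u v -> P x y \/ P y x.
Proof. by case=> [[-> ->]|[-> ->]]; [left|right]. Qed.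

Lemma symC u v x y : sym u v (x, y) -> sym u v (y, x).
Proof. by case=> [[-> ->]|[-> ->]]; [right|left]. Qed.

Lemma a_even n : a (2 * n) = 3 * n.
Proof. by rewrite /a; lia. Qed.

Lemma a_odd n : 0 < n -> a (2 * n - 1) = 3 * n - 2.
Proof. by rewrite /a; lia. Qed.

Lemma S_set_sym x y : S_set (x, y) -> S_set (y, x).
Proof.
case=> [[i [i0 /symC si]]|[-> ->]]; last by right.
by left; exists i.
Qed.

Lemma ordered_pos_S x y : ordered_pos x y -> S_set (x, y).
Proof.
case=> [[-> ->]|[x1 ->]|[x0 x3 yE]]; first by right.
- left; exists (2 * (x %/ 3) + 1); split; first by lia.
  by rewrite /a /b; left => /=; congr pair; lia.
- left; exists (2 * (x %/ 3)); split; first by lia.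
  by rewrite /a /b; left => /=; congr pair; lia.
Qed.

Lemma S_setP x y : S_set (x, y) <-> ordered_pos x y \/ ordered_pos y x.
Proof.
split=> [|[/ordered_pos_S//|/ordered_pos_S/S_set_sym//]].
case=> [[i [i0]]|[-> ->]]; last by left; apply: Or31.
move/symP; apply; rewrite /a /b.
have [i1|i1] : i %% 2 = 1 \/ i %% 2 = 0 by lia.
  by apply: Or32; lia.
by apply: Or33; split; lia.
Qed.

Lemma mouse_trap_moves_sym i j :
  mouse_trap_moves (i, j) -> mouse_trap_moves (j, i).
Proof.
case=> [[[[M|]|]|]|].
- left; left; left; left; move: M; rewrite /M0 /sym /=; intuition congruence.
- by case=> m [n [? ? ? /symC ?]]; left; left; left; right; exists m, n.
- by case=> m [n [? ? ? /symC ?]]; left; left; right; exists m, n.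
- case=> n [n3 M]; left; right; exists n; split=> //.
  by case: M => /symC; [left|right].
- by case=> x [x0 /symC ?]; right; exists x.
Qed.

Lemma ordered_move_moves i j : ordered_move i j -> mouse_trap_moves (i, j).
Proof.
case=> [|[i1 j1 i7 ij]|[i0 j0 i9 ij]|[[i0 i9 jE]|[-> j0]]].
- rewrite !inE !xpair_eqE => M; left; left; left; left; move: M.
  by repeat (case/orP); case/andP => /eqP-> /eqP->; rewrite /M0 /sym /=;
    intuition.
- left; left; left; right; exists ((j + 2) %/ 3), ((i + 2) %/ 3).
  split; try lia.
  by rewrite !a_odd; try lia; left => /=; congr pair; lia.
- left; left; right; exists (j %/ 3), (i %/ 3); split; try lia.
  by rewrite !a_even; left => /=; congr pair; lia.
- left; right; exists (i %/ 3); split; first by lia.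
  by case: jE => jE; [left|right]; left; rewrite /= /a; congr pair; lia.
- by right; exists j; split=> //; left.
Qed.

Lemma mouse_trap_movesP i j :
  mouse_trap_moves (i, j) <-> ordered_move i j \/ ordered_move j i.
Proof.
split=> [|[/ordered_move_moves//|/ordered_move_moves/mouse_trap_moves_sym//]].
case=> [[[[M|]|]|]|].
- have sm u v : (u, v) \in [:: (1, 1); (3, 3); (3, 4); (4, 4); (4, 7); (6, 6);
      (6, 7); (6, 10)] -> ordered_move u v by move=> uv; apply: Or41.
  case: M => [[[[[[[|]|]|]|]|]|]|];
    by [case=> -> ->; left; apply: sm | move/symP; apply; apply: sm].
- case=> m [n [n3 nm mn]]; move/symP; apply; rewrite !a_odd; try lia.
  by apply: Or42; split; lia.
- case=> m [n [n3 nm mn]]; move/symP; apply; rewrite !a_even.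
  by apply: Or43; split; lia.
- case=> n [n3 [|]]; move/symP; apply;
    by apply: Or44; left; rewrite a_even /a; split; lia.
- by case=> x [x0]; move/symP; apply; apply: Or44; right.
Qed.

(** * No move inside [S_set] *)

(** All that the absence of moves inside [S_set] needs to know of the moves. *)
Lemma ordered_move_bounds i j : ordered_move i j ->
  0 < j /\ (i = 0 \/ [/\ 0 < i <= j, j < 2 * i, i %% 3 < 2 & j %% 3 < 2]).
Proof.
case=> [|[i1 j1 i7 ij]|[i0 j0 i9 ij]|[[i0 i9 jE]|[-> j0]]];
  try by split; [lia | (by left) || (right; split; lia)].
rewrite !inE !xpair_eqE.
by repeat (case/orP); case/andP => /eqP-> /eqP->; split=> //; right.
Qed.

Lemma ordered_pos_indep x y i j : ordered_pos x y -> i <= x -> j <= y ->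
  ordered_move i j \/ ordered_move j i ->
  ~ (ordered_pos (x - i) (y - j) \/ ordered_pos (y - j) (x - i)).
Proof.
move=> pxy ix jy mij.
have bounds : [\/ i = 0 /\ 0 < j, j = 0 /\ 0 < i |
    [/\ 0 < i, 0 < j, i %% 3 < 2, j %% 3 < 2 & j < 2 * i]].
  case: mij => /ordered_move_bounds[gt0 [z|[? ? ? ?]]];
    [by apply: Or31 | | by apply: Or32 |]; by apply: Or33; split; lia.
move=> q.
case: pxy => [[? ?]|[? ?]|[? ? ?]]; case: bounds => [[? ?]|[? ?]|[? ? ? ? ?]];
case: q => [[[? ?]|[? ?]|[? ? ?]]|[[? ?]|[? ?]|[? ? ?]]]; lia.
Qed.

Lemma S_set_indep p q :
  S_set p -> options mouse_trap p q -> ~ S_set q.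
Proof.
case: p => x y /S_setP pxy [i [j [/mouse_trap_movesP mij /= ix jy ->]]] /S_setP.
by case: pxy => pxy; [|move/or_comm]; apply: ordered_pos_indep;
  rewrite // or_comm.
Qed.

(** * Moves into [S_set] *)

Lemma ordered_N_move x y : x <= y -> ~ ordered_pos x y ->
  exists q, options mouse_trap (x, y) q /\ S_set q.
Proof.
move=> xy npos.
have go i j : ordered_move i j \/ ordered_move j i -> i <= x -> j <= y ->
    ordered_pos (x - i) (y - j) \/ ordered_pos (y - j) (x - i) ->
    exists q, options mouse_trap (x, y) q /\ S_set q.
  move=> /mouse_trap_movesP mij ix jy /S_setP Sq.
  by exists (x - i, y - j); split=> //; exists i, j.
have row d : 0 < d -> d <= y ->
    ordered_pos x (y - d) \/ ordered_pos (y - d) x ->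
    exists q, options mouse_trap (x, y) q /\ S_set q.
  move=> d0 dy pos; apply: (go 0 d) => //; last by rewrite subn0.
  by left; apply: Or44; right.
have here : ordered_move x y ->
    exists q, options mouse_trap (x, y) q /\ S_set q.
  move=> mxy; apply: (go x y) => //; first by left.
  by left; rewrite !subnn; apply: Or31.
have to35 : 3 <= x -> 5 <= y -> ordered_move (x - 3) (y - 5) ->
    exists q, options mouse_trap (x, y) q /\ S_set q.
  move=> x3 y5 mxy; apply: (go (x - 3) (y - 5)); rewrite ?leq_subr ?subKn //.
    by left.
  by left; apply: Or33.
have to53 : 5 <= x -> 3 <= y -> ordered_move (x - 5) (y - 3) ->
    exists q, options mouse_trap (x, y) q /\ S_set q.
  move=> x5 y3 mxy; apply: (go (x - 5) (y - 3)); rewrite ?leq_subr ?subKn //.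
    by left.
  by right; apply: Or33.
have [x0|x_gt0] := posnP x.
  have y0 : 0 < y by rewrite lt0n; apply/eqP => y0; apply: npos; apply: Or31.
  by apply: here; rewrite x0; apply: Or44; right.
have not1 : ~ (x %% 3 = 1 /\ y = 2 * x) by move=> ?; apply: npos; apply: Or32.
have not0 : ~ (x %% 3 = 0 /\ y + 1 = 2 * x).
  by move=> [? ?]; apply: npos; apply: Or33.
have [x3|x_lt2] := eqVneq (x %% 3) 2.
  (* x is the larger coordinate of its pair; the smaller one is (x + 1) / 2 *)
  apply: (row (y - (x + 1) %/ 2)); try lia.
  rewrite subKn; last by lia.
  right; have [x2|x2] : x %% 2 = 0 \/ x %% 2 = 1 by lia.
    by apply: Or32; lia.
  by apply: Or33; split; lia.
have [ylarge|ysmall] := leqP (2 * x) y.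
  have [x1|x3] : x %% 3 = 1 \/ x %% 3 = 0 by lia.
    apply: (row (y - 2 * x)); try lia.
    by left; apply: Or32; lia.
  apply: (row (y - (2 * x - 1))); try lia.
  by left; apply: Or33; split; lia.
have [y3|y_lt2] := eqVneq (y %% 3) 2.
  apply: (go (x - (y + 1) %/ 2) 0); try lia.
    by right; apply: Or44; right; lia.
  rewrite subKn ?subn0; last by lia.
  left; have [y2|y2] : y %% 2 = 0 \/ y %% 2 = 1 by lia.
    by apply: Or32; lia.
  by apply: Or33; split; lia.
have [x3|x1] : x %% 3 = 0 \/ x %% 3 = 1 by lia.
  have [y3|y1] : y %% 3 = 0 \/ y %% 3 = 1 by lia.
    have [yle|ylt] := leqP y (2 * x - 9).
      by apply: here; apply: Or43; split; lia.
    (* y is 2x-3 or 2x-6, so (i, j) = (x-3, y-5) has j = 2i-2 or j = 2i-5 *)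
    have [x12|x12] := leqP 12 x.
      by apply: to35; [lia | lia | apply: Or44; left; split; lia].
    have [[xE yE]|[[xE yE]|[[xE yE]|[[xE yE]|[xE yE]]]]] :
        x = 3 /\ y = 3 \/ x = 6 /\ y = 6 \/ x = 6 /\ y = 9 \/
        x = 9 /\ y = 12 \/ x = 9 /\ y = 15 by lia.
    + by subst; apply: here; apply: Or41.
    + by subst; apply: here; apply: Or41.
    + by subst; apply: to35 => //; apply: Or41.
    + by subst; apply: to35 => //; apply: Or41.
    + by subst; apply: to35 => //; apply: Or41.
  have [yle|ylt] := leqP y (2 * x - 8); last first.
    have [x9|x9] := leqP 9 x.
      by apply: here; apply: Or44; left; split; lia.
    have [[xE yE]|[[xE yE]|[xE yE]]] :
        x = 3 /\ y = 4 \/ x = 6 /\ y = 7 \/ x = 6 /\ y = 10 by lia.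
    + by subst; apply: here; apply: Or41.
    + by subst; apply: here; apply: Or41.
    + by subst; apply: here; apply: Or41.
  have [x12|x12] := leqP 12 x.
    by apply: to53; [lia | lia | apply: Or42; split; lia].
  have [xE yE] : x = 9 /\ y = 10 by lia.
  by subst; apply: to53 => //; apply: Or41.
have [y3|y1] : y %% 3 = 0 \/ y %% 3 = 1 by lia.
  have [x10|x10] := leqP 10 x.
    by apply: to35; [lia | lia | apply: Or42; split; lia].
  have [[xE yE]|[[xE yE]|[xE yE]]] :
      x = 4 /\ y = 6 \/ x = 7 /\ y = 9 \/ x = 7 /\ y = 12 by lia.
  + by subst; apply: (go 3 4) => //; [left; apply: Or41 | left; apply: Or32].
  + by subst; apply: to35 => //; apply: Or41.
  + by subst; apply: to35 => //; apply: Or41.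
have [x7|x7] := leqP 7 x.
  by apply: here; apply: Or42; split; lia.
have [[xE yE]|[[xE yE]|[xE yE]]] :
    x = 1 /\ y = 1 \/ x = 4 /\ y = 4 \/ x = 4 /\ y = 7 by lia.
+ by subst; apply: here; apply: Or41.
+ by subst; apply: here; apply: Or41.
+ by subst; apply: here; apply: Or41.
Qed.

Lemma N_position_move p :
  ~ S_set p -> exists q, options mouse_trap p q /\ S_set q.
Proof.
case: p => x y nS.
have [xy|yx] := leqP x y.
  by apply: ordered_N_move => // pxy; apply: nS; apply: ordered_pos_S.
have [|[u v] [[i [j [Mij jy ix [-> ->]]]] Sq]] := ordered_N_move (ltnW yx).
  by move=> pyx; apply: nS; apply/S_set_sym/ordered_pos_S.
exists (x - j, y - i); split; last exact: S_set_sym.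
by exists j, i; split=> //; apply: mouse_trap_moves_sym.
Qed.

Theorem theorem5 : P_positions mouse_trap = S_set.
Proof. exact: P_positions_kernel S_set_indep N_position_move. Qed.
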